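(* Let $D$ be a full-dimensional discrete lattice in $\mathbb{R}^d$, let $P\subset\mathbb{R}^d$ be a full-dimensional, $D$-fractional convex polytope (not necessarily closed), and let $\mathcal{H}$ be a $D$-fractional hyperplane arrangement in $\mathbb{R}^d$ that does not contain the degenerate hyperplane. Then $$E^\circ_{P^\circ,\mathcal{H}}(t) = \sum_{u\in \mathcal{L}(\mathcal{H})} \mu(\hat 0,u)\, E_{P^\circ\cap u}(t),$$ and if $\mathcal{H}$ is transverse to $P$, $$E_{P,\mathcal{H}}(t) = \sum_{u\in \mathcal{L}(\mathcal{H})}|\mu(\hat 0,u)|\,E_{P\cap u}(t),$$ where $\mu$ is the Möbius function of $\mathcal{L}(\mathcal{H})$ and $t$ is a positive integer.
   Context: A discrete lattice $D$ is a locally finite set of points of an affine space that is invariant under every translation carrying some point of $D$ to another point of $D$ (e.g. $\mathbb{Z}^d$); coordinates are chosen so that $0\in D$, and $t^{-1}D=\{t^{-1}x:x\in D\}$. A convex polytope is a bounded nonempty intersection of finitely many open and closed half spaces; it may be closed, relatively open, or neither. $P$ is $D$-fractional if its vertices (those of its closure) all lie in $t^{-1}D$ for some positive integer $t$. A hyperplane arrangement $\mathcal{H}$ in $\mathbb{R}^d$ is a finite set of affine hyperplanes (the whole space $\mathbb{R}^d$ is also allowed as a member and is then called the degenerate hyperplane); it is $D$-fractional if each of its hyperplanes is affinely spanned by the points of $\bigcup_{t\ge1}t^{-1}D$ it contains. $\mathcal{L}(\mathcal{H}) = \{\bigcap\mathcal{S} : \mathcal{S}\subseteq\mathcal{H},\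 \bigcap\mathcal{S}\neq\varnothing\}$ is ordered by reverse inclusion, with minimum $\hat 0=\mathbb{R}^d$; its elements are flats. The Möbius function of a finite poset is defined by $\mu(r,s)=0$ if $r\not\le s$, $\mu(r,r)=1$, and $\mu(r,s)=-\sum_{r\le u<s}\mu(r,u)$ if $r<s$. $\bar P$ is the closure and $P^\circ$ the relative interior of $P$. $\mathcal{H}$ is transverse to $P$ if every flat that intersects $\bar P$ also intersects $P^\circ$, and $P$ does not lie in any hyperplane of $\mathcal{H}$. A closed region of $(P,\mathcal{H})$ is the closure of a connected component of $P\setminus\bigcup\mathcal{H}$. For $x\in\mathbb{R}^d$, $m_{P,\mathcal{H}}(x)$ is the number of closed regions of $(P,\mathcal{H})$ containing $x$ if $x\in P$, and $0$ if $x\notin P$. For positive integers $t$, $$E_{P,\mathcal{H}}(t)=\sum_{x\in t^{-1}D}m_{P,\mathcal{H}}(x),\qquad E^\circ_{P^\circ,\mathcal{H}}(t)=\#\bigl(t^{-1}D\cap[P^\circ\setminus\textstyle\bigcup\mathcal{H}]\bigr),$$ and for any bounded set $Q$, $E_Q(t)=\#(Q\cap t^{-1}D)$. *)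

(* Defs.v *)
From HB Require Import structures.
From mathcomp Require Import all_boot all_order all_algebra finmap.
From mathcomp Require Import all_classical all_reals all_analysis.

Set Implicit Arguments.
Unset Strict Implicit.
Unset Printing Implicit Defensive.

Import Order.TTheory GRing.Theory Num.Theory.
Import numFieldNormedType.Exports.

Local Open Scope classical_set_scope.
Local Open Scope ring_scope.

(* The cardinality of a finite set, and 0 (by convention) for an infinite one. *)
Definition ncard (T : choiceType) (A : set T) : nat := #|` fset_set A|.

Lemma ncard_lt (T : choiceType) (A B : set T) (s : T) :
  finite_set B -> A `<=` B -> B s -> ~ A s -> (ncard A < ncard B)%N.
Proof.
move=> finB AB Bs nAs; have finA := sub_finite_set AB finB.
apply: fproper_ltn_card; rewrite fproperE; apply/andP; split.
  by apply/fsubsetP => v; rewrite !in_fset_set ?inE //; exact: AB.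
apply/negP => /fsubsetP/(_ s); rewrite !in_fset_set ?inE //.
by move=> /(_ Bs).
Qed.

Section Mobius.
Context {T : choiceType}.
Variables (L : set T) (le : T -> T -> Prop).

Definition below (r s : T) : set T :=
  [set u | [/\ L u, le r u, le u s & u <> s]].

(* The fuel n bounds the length of the chains from r to s. *)
Fixpoint mobius_rec (n : nat) (r s : T) : int :=
  if n is n'.+1 then
    if r == s then 1
    else if `[< le r s >] then - \sum_(u \in below r s) mobius_rec n' r u
    else 0
  else 0.

(* The Mobius function of the finite poset (L, le); it is only meaningful at
   elements of L, where #|L| is enough fuel: see mobius_xx, mobius_nle and
   mobius_lt for the defining recursion. *)
Definition mobius (r s : T) : int := mobius_rec (ncard L) r s.

Hypothesis finL : finite_set L.
Hypothesis le_trans : forall x y z, le x y -> le y z -> le x z.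
Hypothesis le_anti : forall x y, le x y -> le y x -> x = y.

Lemma finite_below r s : finite_set (below r s).
Proof. by apply: sub_finite_set finL => u []. Qed.

Lemma ncard_below_lt r s u : below r s u ->
  (ncard (below r u) < ncard (below r s))%N.
Proof.
move=> us; have [Lu ru lus nus] := us.
apply: (@ncard_lt _ _ _ u) => //; first exact: finite_below.
  move=> v [Lv rv vu nvu]; split => //; first exact: le_trans vu lus.
  by move=> evs; apply: nvu; apply: le_anti => //; rewrite evs.
by case.
Qed.

Lemma mobius_rec_stable n m r s :
  (ncard (below r s) < n)%N -> (ncard (below r s) < m)%N ->
  mobius_rec n r s = mobius_rec m r s.
Proof.
elim: n m s => // n IH [//|m] s hn hm /=.
case: ifP => // _; case: ifP => // _; congr (- _).
apply: eq_fsbigr => u /set_mem us; have h := ncard_below_lt us.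
by apply: IH; exact: leq_trans h _.
Qed.

Lemma ncard_below r s : L s -> (ncard (below r s) < ncard L)%N.
Proof.
by move=> Ls; apply: (@ncard_lt _ _ _ s) => // [v|] [].
Qed.

Lemma mobius_xx r : L r -> mobius r r = 1.
Proof.
move=> Lr; have := ncard_below r Lr; rewrite /mobius.
by case: (ncard L) => //= n _; rewrite eqxx.
Qed.

Lemma mobius_nle r s : L s -> ~ le r s -> r <> s -> mobius r s = 0.
Proof.
move=> Ls nrs /eqP/negPf rs; have := ncard_below r Ls; rewrite /mobius.
by case: (ncard L) => //= n _; rewrite rs asboolF.
Qed.

Lemma mobius_lt r s : L s -> le r s -> r <> s ->
  mobius r s = - \sum_(u \in below r s) mobius r u.
Proof.
move=> Ls lrs /eqP/negPf rs; have := ncard_below r Ls; rewrite /mobius.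
case E : (ncard L) => [//|n] h /=; rewrite rs asboolT //; congr (- _).
apply: eq_fsbigr => u /set_mem us; apply: (@mobius_rec_stable n n.+1).
  by apply: leq_trans (ncard_below_lt us) _; rewrite -ltnS.
by rewrite -E; apply: ncard_below; case: us.
Qed.

End Mobius.

Section Geometry.
Context {R : realType} {d : nat}.
Local Notation V := 'rV[R]_d.
Implicit Types (A D P Q : set V) (H : set (set V)).

Definition dotp (a x : V) : R := \sum_i a 0 i * x 0 i.

Definition affine_hull A : set V :=
  [set x | exists n (c : 'I_n -> R) (p : 'I_n -> V),
     [/\ forall i, A (p i), \sum_i c i = 1 & x = \sum_i c i *: p i]].

Definition full_dimensional A : Prop := affine_hull A = setT.

Definition relint A : set V :=
  [set x | A x /\ \forall y \near x, affine_hull A y -> A y].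

Definition locally_finite A : Prop :=
  forall x : V, exists2 U, nbhs x U & finite_set (A `&` U).

Definition discrete_lattice D : Prop :=
  locally_finite D /\
  forall v : V, (exists2 x, D x & D (x + v)) -> [set y + v | y in D] = D.

Definition dilate_inv (t : nat) D : set V := [set t%:R^-1 *: x | x in D].

Definition is_halfspace (h : set V) : Prop :=
  exists (a : V) (b : R), a != 0 /\
    (h = [set x | dotp a x <= b] \/ h = [set x | dotp a x < b]).

Definition polytope P : Prop :=
  [/\ bounded_set P, P !=set0 &
   exists F : set (set V),
     [/\ finite_set F, F `<=` is_halfspace & P = \bigcap_(h in F) h]].

(* Extreme points, which are the vertices when A is a closed polytope. *)
Definition vertices A : set V :=
  [set v | A v /\ forall x y (c : R), A x -> A y -> 0 < c < 1 ->
     v = c *: x + (1 - c) *: y -> x = v /\ y = v].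

Definition fractional_polytope D P : Prop :=
  exists2 t : nat, (0 < t)%N & vertices (closure P) `<=` dilate_inv t D.

Definition is_hyperplane (h : set V) : Prop :=
  exists (a : V) (b : R), a != 0 /\ h = [set x | dotp a x = b].

(* The whole space setT is the degenerate hyperplane. *)
Definition arrangement H : Prop :=
  finite_set H /\ forall h, H h -> is_hyperplane h \/ h = setT.

Definition fractional_points D : set V :=
  \bigcup_(t in [set t | (0 < t)%N]) dilate_inv t D.

Definition fractional_arrangement D H : Prop :=
  forall h, H h -> affine_hull (h `&` fractional_points D) = h.

Definition flats H : set (set V) :=
  [set u | u !=set0 /\ exists2 S, S `<=` H & u = \bigcap_(h in S) h].

Definition mobius_flats H : set V -> set V -> int :=
  mobius (flats H) (fun u v => v `<=` u).

Definition transverse H P : Prop :=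
  (forall u, flats H u -> u `&` closure P !=set0 -> u `&` relint P !=set0) /\
  (forall h, H h -> ~ (P `<=` h)).

Definition closed_regions P H : set (set V) :=
  let A := P `\` \bigcup_(h in H) h in
  [set closure (connected_component A x) | x in A].

Definition multiplicity P H (x : V) : nat :=
  if x \in P then ncard [set C | closed_regions P H C /\ C x] else 0%N.

Definition ehrhart D Q (t : nat) : nat := ncard (Q `&` dilate_inv t D).

(* A sum over an infinite set with finite support, as P is bounded. *)
Definition ehrhart_closed D P H (t : nat) : nat :=
  (\big[addn/0]_(x \in dilate_inv t D) multiplicity P H x)%N.

(* The first argument Q is meant to be the relative interior of a polytope. *)
Definition ehrhart_open D Q H (t : nat) : nat :=
  ncard (dilate_inv t D `&` (Q `\` \bigcup_(h in H) h)).

End Geometry.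

(* Main.v *)
Require Import Defs.
From mathcomp Require Import all_boot all_order all_algebra finmap lra.
From mathcomp Require Import all_classical all_reals all_analysis.

Set Implicit Arguments.
Unset Strict Implicit.
Unset Printing Implicit Defensive.

Import Order.TTheory GRing.Theory Num.Theory.
Import numFieldNormedType.Exports.
Local Open Scope classical_set_scope.
Local Open Scope ring_scope.

(** Both formulas are proved one point at a time: exchanging the sum over flats
    with the count of lattice points ([sum_incidence]) reduces them to a
    statement about a single point x and the set W of hyperplanes through x.

    Write the hyperplanes as a_i . y = b_i. The crosscut theorem
    ([mobius_flatsE]) says that mu(0,u) is the sum of (-1)^|S| over the sets S
    of hyperplanes with intersection u: both sides satisfy the same recursion,
    because the subsets of a nonempty set have alternating sum 0. Summed over
    the flats through x it gives the alternating sum over all S inside W, which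
    is 1 if W is empty and 0 otherwise. This is the first formula.

    For the second one the number of closed regions at x must equal the sum of
    |mu(0,u)| over the flats u through x.

    Combinatorially, this is Zaslavsky's theorem for the central arrangement W.
    Sets S with the same intersection have the same rank, so the sign
    (-1)^(rank S) can be put inside the crosscut sum of a flat without changing
    its absolute value. The signed sums over S of (-1)^(|S| + rank S) satisfy
    deletion-restriction: if the form a_i does not vanish on the ambient
    subspace, the sum for W is the sum for W minus i plus the sum for W minus i
    restricted to the kernel of a_i; if it does vanish, the sum is 0. Hence
    these sums are nonnegative flat by flat ([whitney_sum_ge0]), so that they
    are the |mu(0,u)| ([abs_mobius_flatsE]), and in total they count the sign
    patterns that W realizes ([count_realizable]), since realizable patterns
    obey the same recursion.

    Geometrically, the components of P minus the hyperplanes are the sign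
    classes in P ([component_cell]). A class whose closure contains x has the
    signs of x off W, and on W a realizable pattern. Conversely a pattern
    realized by a direction w does occur at x ([realizable_closure]):
    transversality provides a point y in the interior of P lying on every
    hyperplane of W, and moving from x towards y + e w, for a small e > 0,
    stays in P by convexity and produces the signs of w on W. *)

(** * Sums over the subsets of a finite set *)

Lemma set_indU1 (I : finType) (Q : {set I} -> Prop) :
  Q finset.set0 ->
  (forall i (A : {set I}), i \notin A -> Q A -> Q (i |: A)) -> forall A, Q A.
Proof.
move=> Q0 QU A; have [n] := ubnP #|A|; elim: n A => // n IH A An.
have [->//|[i iA]] := finset.set_0Vmem A.
rewrite -(finset.setD1K iA); apply: QU; first by rewrite !inE eqxx.
by apply: IH; move: An; rewrite (finset.cardsD1 i A) iA add1n ltnS.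
Qed.

Lemma sum_subsetU1 (I : finType) (V : nmodType) (A : {set I}) (i : I)
    (F : {set I} -> V) : i \notin A ->
  \sum_(S : {set I} | S \subset i |: A) F S =
  \sum_(S : {set I} | S \subset A) F S +
  \sum_(S : {set I} | S \subset A) F (i |: S).
Proof.
move=> iA; rewrite (bigID (fun S : {set I} => i \notin S)) /=; congr (_ + _).
  apply: eq_bigl => S; apply/andP/idP => [[SA iS]|SA].
    apply/fintype.subsetP => j jS; have := fintype.subsetP SA j jS.
    by rewrite !inE => /predU1P[ji|//]; rewrite -ji jS in iS.
  split; first exact: fintype.subset_trans SA (finset.subsetUr _ _).
  by apply: contraNN iA; exact: (fintype.subsetP SA).
rewrite (reindex_onto (fun S : {set I} => i |: S) (fun S => S :\ i)) /=;
  last first.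
  by move=> S; rewrite negbK => /andP[_ iS]; rewrite finset.setD1K.
apply: eq_bigl => S; rewrite finset.setU11 andbT; apply/andP/idP.
  move=> [SA /eqP SE]; apply/fintype.subsetP => j jS.
  have := fintype.subsetP SA j; rewrite !inE jS orbT => /(_ isT) /predU1P[ji|//].
  by move: jS; rewrite -SE ji !inE eqxx.
move=> SA; split; first exact: finset.setUS.
apply/eqP; apply: finset.setU1K; apply: contraNN iA; exact: (fintype.subsetP SA).
Qed.

(** * Sign patterns of linear forms: deletion and restriction *)

Section LinearForms.
Context {R : realType} {d : nat} {I : finType}.
Variable a : I -> 'rV[R]_d.
Implicit Types (A S s : {set I}) (K : 'M[R]_d) (x : 'rV[R]_d).

(** A subspace of the ambient space is encoded by the row space [K] of the
    forms vanishing on it; restricting to the kernel of [a i] replaces [K] by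
    [K + <<a i>>]. *)
Definition form_span K S : 'M[R]_d := (K + \sum_(i in S) <<a i>>)%MS.

Lemma form_span0 K : (form_span K finset.set0 :=: K)%MS.
Proof. by rewrite /form_span big_set0; exact: addsmx0. Qed.

Lemma form_spanU1 K S i : i \notin S ->
  (form_span K (i |: S) :=: form_span (K + <<a i>>)%MS S)%MS.
Proof.
move=> iS; rewrite /form_span big_setU1 //= !addsmxA. exact: eqmx_refl.
Qed.

(** The parity of |S| + (rank of S modulo [K]); the difference of the two ranks
    is written as a sum, which has the same parity. *)
Definition whitney_sign K S : int :=
  (-1) ^+ (#|S| + \rank (form_span K S) + \rank K).

(** The set [s] encodes a sign pattern on [A]: it lists the forms which are
    positive. *)
Definition realizes K A (s : {set I}) x : Prop :=
  K *m x^T = 0 /\ forall i, i \in A ->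
    if i \in s then 0 < dotp (a i) x else dotp (a i) x < 0.

Definition realizable K A s : Prop := exists x, realizes K A s x.

Lemma dotpE (b x : 'rV[R]_d) : dotp b x = (b *m x^T) 0 0.
Proof. by rewrite mxE; apply: eq_bigr => i _; rewrite mxE. Qed.

Lemma dotpDr (b x y : 'rV[R]_d) : dotp b (x + y) = dotp b x + dotp b y.
Proof. by rewrite !dotpE linearD mulmxDr mxE. Qed.

Lemma dotpZr (b x : 'rV[R]_d) c : dotp b (c *: x) = c * dotp b x.
Proof. by rewrite !dotpE linearZ -scalemxAr mxE. Qed.

Lemma dotp_eq0 (b x : 'rV[R]_d) : dotp b x = 0 <-> b *m x^T = 0.
Proof.
rewrite dotpE; split => [h|->]; last by rewrite mxE.
by apply/matrixP => i j; rewrite !ord1 h mxE.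
Qed.

Lemma submx_ann m n (M : 'M[R]_(m, d)) (N : 'M[R]_(n, d)) x :
  (M <= N)%MS -> N *m x^T = 0 -> M *m x^T = 0.
Proof. by move=> /submxP[D ->] h; rewrite -mulmxA h mulmx0. Qed.

Lemma ann_addsmx K (b x : 'rV[R]_d) :
  (K + <<b>>)%MS *m x^T = 0 <-> K *m x^T = 0 /\ dotp b x = 0.
Proof.
rewrite dotp_eq0; split => [h|[hK hb]].
  split; apply: submx_ann h; first exact: addsmxSl.
  by apply: submx_trans (addsmxSr _ _); rewrite genmxE.
have : (K + <<b>> <= col_mx K b)%MS.
  by rewrite -addsmxE; apply: addsmxS => //; rewrite genmxE.
by move=> /submx_ann; apply; rewrite mul_col_mx hK hb col_mx0.
Qed.

Lemma ann_separate K (b : 'rV[R]_d) : ~~ (b <= K)%MS ->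
  exists v : 'rV[R]_d, K *m v^T = 0 /\ 0 < dotp b v.
Proof.
rewrite submxE => /eqP/matrixP hb.
have [j hj] : exists j, (b *m cokermx K) 0 j != 0.
  apply: contrapT => h; apply: hb => i j; rewrite ord1 [in RHS]mxE.
  by apply/eqP; apply: contrapT => /negP hj; apply: h; exists j.
set v0 := (col j (cokermx K))^T.
have Kv : K *m v0^T = 0.
  by rewrite trmxK colE mulmxA mulmx_coker mul0mx.
have bv : dotp b v0 = (b *m cokermx K) 0 j.
  by rewrite dotpE trmxK colE mulmxA -colE mxE.
exists (dotp b v0 *: v0); split; first by rewrite linearZ -scalemxAr Kv scaler0.
by rewrite dotpZr -expr2 exprn_even_gt0 //= bv.
Qed.

Lemma rank_adds_notin K (b : 'rV[R]_d) : ~~ (b <= K)%MS ->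
  \rank (K + <<b>>) = (\rank K).+1.
Proof.
move=> bK.
have capK0 : (K :&: <<b>>)%MS = 0.
  have lt : (\rank (K :&: <<b>>) < \rank <<b>>)%N.
    have [le eq] := mxrank_leqif_sup (capmxSr K <<b>>)%MS.
    rewrite ltn_neqAle le andbT eq.
    apply: contraNN bK => h; have : (<<b>> <= K)%MS.
      by apply: submx_trans h (capmxSl _ _).
    by rewrite genmxE.
  apply/eqP; rewrite -mxrank_eq0 -leqn0 -ltnS.
  by apply: leq_trans lt _; rewrite mxrank_gen rank_rV leq_b1.
rewrite mxrank_disjoint_sum // mxrank_gen rank_rV.
by case: eqP bK => [->|_ _]; rewrite ?sub0mx // addn1.
Qed.

Lemma dotp_continuous (b : 'rV[R]_d) : continuous (dotp b).
Proof.
rewrite /dotp; move: (index_enum _) => s x; elim: s => [|j s IH].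
  rewrite (_ : (fun _ => _) = cst 0); first exact: cst_continuous.
  by apply/funext => y; rewrite big_nil.
rewrite (_ : (fun _ => _) =
    (fun y : 'rV[R]_d => b 0 j * y 0 j) \+
    (fun y => \sum_(i <- s) b 0 i * y 0 i)); last first.
  by apply/funext => y; rewrite big_cons.
apply: continuousD IH; apply: continuousM; first exact: cst_continuous.
exact: coord_continuous.
Qed.

Lemma near_dotp_gt (b x : 'rV[R]_d) c : c < dotp b x ->
  \forall y \near x, c < dotp b y.
Proof. by move=> h; exact: (cvgr_gt (dotp b x) (dotp_continuous (x := x))). Qed.

Lemma near_dotp_lt (b x : 'rV[R]_d) c : dotp b x < c ->
  \forall y \near x, dotp b y < c.
Proof. by move=> h; exact: (cvgr_lt (dotp b x) (dotp_continuous (x := x))). Qed.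

Lemma cvg_line x (v : 'rV[R]_d) : x + e *: v @[e --> (0 : R)] --> x.
Proof.
have : x + e *: v @[e --> (0 : R)] --> x + 0 *: v.
  by apply: cvgD; [exact: cvg_cst | apply: cvgZr_tmp; exact: cvg_id].
by rewrite scale0r addr0.
Qed.

(** Strict inequalities are open conditions, and finitely many are imposed. *)
Lemma near_realizes K A s x (v : 'rV[R]_d) : realizes K A s x ->
  K *m v^T = 0 -> exists2 e : R, 0 < e & realizes K A s (x + e *: v) /\
                                         realizes K A s (x - e *: v).
Proof.
move=> [Kx hx] Kv.
have near_sign : \forall y \near x, forall i, i \in A ->
    if i \in s then 0 < dotp (a i) y else dotp (a i) y < 0.
  pose f i (y : 'rV[R]_d) := i \in A ->
    if i \in s then 0 < dotp (a i) y else dotp (a i) y < 0.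
  apply: (@filter_forall _ _ f (nbhs x)) => i; rewrite /f.
  case: (boolP (i \in A)) => [/hx|iA].
    case: ifP => _ h.
      by apply: filterS (near_dotp_gt h).
    by apply: filterS (near_dotp_lt h).
  by apply: nearW.
have near_line (w : 'rV[R]_d) : K *m w^T = 0 ->
    \forall e \near (0 : R), realizes K A s (x + e *: w).
  move=> Kw; have Kline (e : R) : K *m (x + e *: w)^T = 0.
    by rewrite linearD linearZ mulmxDr -scalemxAr Kx Kw scaler0 addr0.
  apply: (@filterS _ (nbhs (0 : R)) _ _ _ _ (@cvg_line x w _ near_sign)).
  move=> e /= he.
  by split=> //; exact: Kline.
have KNv : K *m (- v)^T = 0 by rewrite linearN mulmxN Kv oppr0.
have /nbhs_ballP[e /= e0 he] : nbhs (0 : R) (fun e : R =>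
    realizes K A s (x + e *: v) /\ realizes K A s (x + e *: - v)).
  by apply: filterI; apply: near_line.
exists (e / 2); first exact: divr_gt0.
have /he[] : ball (0 : R) e (e / 2).
  rewrite /ball /= sub0r normrN gtr0_norm ?divr_gt0 //.
  by rewrite ltr_pdivrMr // ltr_pMr // ltr1n.
by rewrite scalerN.
Qed.

Lemma realizesU1_neg K A s i x : i \notin s -> i \notin A ->
  realizes K (i |: A) s x <-> realizes K A s x /\ dotp (a i) x < 0.
Proof.
move=> iS iA; split=> [[Kx h]|[[Kx h] hi]].
  split; first by split=> // j jA; apply: h; rewrite inE jA orbT.
  by have := h i; rewrite (negPf iS); apply; rewrite !inE eqxx.
by split=> // j; rewrite !inE => /predU1P[->|/h//]; rewrite (negPf iS).
Qed.

Lemma realizesU1_pos K A s i x : i \notin s -> i \notin A ->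
  realizes K (i |: A) (i |: s) x <-> realizes K A s x /\ 0 < dotp (a i) x.
Proof.
move=> iS iA; split=> [[Kx h]|[[Kx h] hi]].
  split; last by have := h i; rewrite !inE eqxx; apply.
  split=> // j jA; have := h j; rewrite !inE jA orbT => /(_ isT).
  by case: eqP => [ji|//]; rewrite -ji jA in iA.
split=> // j; rewrite !inE => /predU1P[->|jA]; first by rewrite eqxx.
by case: eqP => [ji|_]; [rewrite -ji jA in iA | exact: h].
Qed.

(** The recursion of sign patterns. A pattern on [A] extends to the new form by
    at least one sign; it extends by both exactly when it is realized on the
    kernel of [a i], since points on both sides have a positive combination on
    that kernel, and a point of the kernel can be pushed to either side. *)
Lemma realizable_split K A s i : i \notin s -> i \notin A ->
  ~~ (a i <= K)%MS ->
  (`[< realizable K (i |: A) s >] + `[< realizable K (i |: A) (i |: s) >] =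
   `[< realizable K A s >] + `[< realizable (K + <<a i>>)%MS A s >])%N.
Proof.
move=> iS iA aK; have [v [Kv av]] := ann_separate aK.
have wall x : realizes (K + <<a i>>)%MS A s x <->
    realizes K A s x /\ dotp (a i) x = 0.
  by rewrite /realizes ann_addsmx; tauto.
have toboth : realizable (K + <<a i>>)%MS A s ->
    realizable K (i |: A) s /\ realizable K (i |: A) (i |: s).
  move=> [x /wall[rx ax]]; have [e e0 [rp rm]] := near_realizes rx Kv.
  split; [exists (x - e *: v); apply/realizesU1_neg => // |
          exists (x + e *: v); apply/realizesU1_pos => //]; split=> //.
    by rewrite -scaleNr dotpDr dotpZr ax add0r mulNr oppr_lt0 mulr_gt0.
  by rewrite dotpDr dotpZr ax add0r mulr_gt0.
have fromboth : realizable K (i |: A) s -> realizable K (i |: A) (i |: s) ->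
    realizable (K + <<a i>>)%MS A s.
  move=> [x /realizesU1_neg[]// [Kx hx] ax] [y /realizesU1_pos[]// [Ky hy] ay].
  (* both coefficients are positive and the value of [a i] cancels *)
  exists (dotp (a i) y *: x - dotp (a i) x *: y); apply/wall; split; last first.
    by rewrite -scaleNr dotpDr !dotpZr mulNr mulrC subrr.
  split.
    by rewrite linearB mulmxBr !linearZ /= Kx Ky oppr0 !scaler0 addr0.
  move=> j jA; have := hx j jA; have := hy j jA; rewrite -scaleNr dotpDr !dotpZr.
  move: ax; rewrite -oppr_gt0; case: (j \in s) => axn hyj hxj.
    by rewrite addr_gt0 // mulr_gt0.
  by rewrite -[ltRHS]addr0 ltrD // pmulr_rlt0.
have weakenN : realizable K (i |: A) s -> realizable K A s.
  by move=> [x /realizesU1_neg[]// rx _]; exists x.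
have weakenP : realizable K (i |: A) (i |: s) -> realizable K A s.
  by move=> [x /realizesU1_pos[]// rx _]; exists x.
have extend : realizable K A s ->
    realizable K (i |: A) s \/ realizable K (i |: A) (i |: s).
  move=> [x rx]; have [h|h|h] := ltrgtP (dotp (a i) x) 0.
  - by left; exists x; apply/realizesU1_neg.
  - by right; exists x; apply/realizesU1_pos.
  - have [] // : realizable K (i |: A) s /\ realizable K (i |: A) (i |: s).
      by apply: toboth; exists x; apply/wall.
    by left.
case: asboolP => hN; case: asboolP => hP; case: asboolP => hX;
  case: asboolP => hZ //; tauto.
Qed.

Lemma realizable_degenerate K A s i : i \in A -> (a i <= K)%MS ->
  ~ realizable K A s.
Proof.
move=> iA aK [x [Kx /(_ i iA)]]; have /dotp_eq0 -> := submx_ann aK Kx.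
by rewrite ltxx; case: ifP.
Qed.

Lemma whitney_signU1_in K S i : i \notin S -> (a i <= K)%MS ->
  whitney_sign K (i |: S) = - whitney_sign K S.
Proof.
move=> iS aK; have KE : (K + <<a i>> :=: K)%MS.
  by apply/eqmxP; rewrite addsmxSl addsmx_sub submx_refl genmxE aK.
have eqr : \rank (form_span K (i |: S)) = \rank (form_span K S).
  rewrite (form_spanU1 _ iS) /form_span.
  by rewrite (adds_eqmx KE (eqmx_refl _)).
by rewrite /whitney_sign eqr cardsU1 iS add1n 2!addSn exprS mulN1r.
Qed.

Lemma whitney_signU1_notin K S i : i \notin S -> ~~ (a i <= K)%MS ->
  whitney_sign K (i |: S) = whitney_sign (K + <<a i>>)%MS S.
Proof.
move=> iS aK; rewrite /whitney_sign (form_spanU1 _ iS) rank_adds_notin //.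
by rewrite cardsU1 iS add1n !addSn addnS.
Qed.

(** Zaslavsky's theorem for a list of linear forms, possibly with repetitions
    or forms vanishing on the ambient subspace: the two sides satisfy the same
    deletion-restriction recursion. *)
Theorem count_realizable K A :
  \sum_(s : {set I} | s \subset A) (`[< realizable K A s >] : nat)%:Z =
  \sum_(S : {set I} | S \subset A) whitney_sign K S.
Proof.
elim/set_indU1 : A K => [|i A iA IH] K.
  have eqS (S : {set I}) : (S \subset finset.set0) = (S == finset.set0).
    by rewrite finset.subset0.
  rewrite !(eq_bigl _ _ eqS) !big_pred1_eq asboolT; last first.
    by exists 0; split=> [|i]; rewrite ?inE // trmx0 mulmx0.
  rewrite /whitney_sign form_span0 cards0 add0n.
  by rewrite -signr_odd oddD addbb.
rewrite !sum_subsetU1 // -!big_split /=.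
have notin (S : {set I}) : S \subset A -> i \notin S.
  by move=> SA; apply: contraNN iA; exact: (fintype.subsetP SA).
case: (boolP (a i <= K)%MS) => aK.
  rewrite [RHS]big1 => [|S SA]; last by rewrite whitney_signU1_in ?subrr ?notin.
  rewrite big1 // => S SA.
  by rewrite !asboolF //; apply: realizable_degenerate aK; rewrite setU11.
transitivity (\sum_(S : {set I} | S \subset A)
    ((`[< realizable K A S >] : nat)%:Z +
     (`[< realizable (K + <<a i>>)%MS A S >] : nat)%:Z)).
  apply: eq_bigr => S SA.
  by rewrite -!PoszD realizable_split ?notin.
rewrite big_split /= !IH -big_split /=.
by apply: eq_bigr => S SA; rewrite whitney_signU1_notin ?notin.
Qed.

(** The same recursion as for [count_realizable] applies when the sum is limited
    to the sets [S] spanning a prescribed space [M]; this is Rota's theorem on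
    the alternation of the signs of the Mobius function. *)
Theorem whitney_sum_ge0 K A (M : 'M[R]_d) :
  0 <= \sum_(S : {set I} | (S \subset A) && (form_span K S == M)%MS)
         whitney_sign K S.
Proof.
elim/set_indU1 : A K => [|i A iA IH] K.
  rewrite big_mkcondr; apply: sumr_ge0 => S.
  rewrite finset.subset0 => /eqP ->; case: ifP => // _.
  rewrite /whitney_sign form_span0 cards0 add0n.
  by rewrite -signr_odd oddD addbb.
rewrite big_mkcondr sum_subsetU1 // -big_split /=.
have notin (S : {set I}) : S \subset A -> i \notin S.
  by move=> SA; apply: contraNN iA; exact: (fintype.subsetP SA).
case: (boolP (a i <= K)%MS) => aK.
  rewrite big1 // => S SA; rewrite whitney_signU1_in ?notin //.
  have E : (form_span K (i |: S) :=: form_span K S)%MS.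
    apply: eqmx_trans (form_spanU1 _ (notin _ SA)) _; apply: adds_eqmx => //.
    by apply/eqmxP; rewrite addsmxSl addsmx_sub submx_refl genmxE aK.
  by rewrite !E; case: ifP; rewrite ?addr0 ?subrr.
rewrite big_split /= -!big_mkcondr /=; apply: addr_ge0; first exact: IH.
rewrite (_ : \sum_(_ | _) _ =
  \sum_(S : {set I} | (S \subset A) && (form_span (K + <<a i>>)%MS S == M)%MS)
     whitney_sign (K + <<a i>>)%MS S); first exact: IH.
apply: eq_big => S; last by case/andP=> SA _; rewrite whitney_signU1_notin ?notin.
by case: (boolP (S \subset A)) => //= /notin iS; rewrite !(form_spanU1 _ iS).
Qed.

End LinearForms.

(** * Annihilators and fibrewise sums *)

Lemma ann_form_span (R : realType) (d : nat) (I : finType) (a : I -> 'rV[R]_d)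
    (K : 'M[R]_d) (S : {set I}) (x : 'rV[R]_d) :
  form_span a K S *m x^T = 0 <->
  K *m x^T = 0 /\ forall i, i \in S -> dotp (a i) x = 0.
Proof.
split=> [/eqP|[/eqP Kx Sx]].
  rewrite -sub_kermx addsmx_sub !sub_kermx => /andP[/eqP Kx].
  rewrite -sub_kermx => /sumsmx_subP Sx; split=> // i /Sx.
  by rewrite genmxE sub_kermx => /eqP/dotp_eq0.
apply/eqP; rewrite -sub_kermx addsmx_sub sub_kermx Kx /=.
apply/sumsmx_subP => i iS; rewrite genmxE sub_kermx.
by apply/eqP/dotp_eq0; exact: Sx.
Qed.

(** Duality: a larger annihilator comes from a smaller row space. The columns of
    [cokermx M] span the annihilator of [M]. *)
Lemma ann_submx (R : realType) (d : nat) (M N : 'M[R]_d) :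
  (forall x : 'rV_d, M *m x^T = 0 -> N *m x^T = 0) -> (N <= M)%MS.
Proof.
move=> h; rewrite submxE; apply/eqP/matrixP => i j; rewrite [RHS]mxE.
have : N *m ((col j (cokermx M))^T)^T = 0.
  by apply: h; rewrite trmxK colE mulmxA mulmx_coker mul0mx.
rewrite trmxK colE mulmxA -colE => /matrixP/(_ i 0).
by rewrite !mxE.
Qed.

Lemma sum_subset_sign (I : finType) (A : {set I}) :
  \sum_(S : {set I} | S \subset A) (-1) ^+ #|S| = (A == finset.set0)%:Z.
Proof.
elim/set_indU1 : A => [|i A iA _].
  rewrite (eq_bigl (pred1 finset.set0)); last by move=> S; rewrite finset.subset0.
  by rewrite big_pred1_eq cards0 eqxx.
rewrite sum_subsetU1 // -big_split /= big1 => [|S SA].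
  case: eqP => // /setP/(_ i); rewrite !inE eqxx //.
have iS : i \notin S by apply: contraNN iA; exact: (fintype.subsetP SA).
by rewrite cardsU1 iS exprS mulN1r subrr.
Qed.

Lemma ncardE (T : choiceType) (X : set T) : finite_set X ->
  (ncard X)%:Z = \sum_(x \in X) (1 : int).
Proof.
by move=> finX; rewrite fsbig_finite //= big_const_seq count_predT iter_addr_0 natz.
Qed.

Lemma fsbig_fibers (I : finType) (T : choiceType) (V : nmodType) (f : I -> T)
    (X : set T) (F : I -> V) : finite_set X ->
  \sum_(v \in X) \sum_(i | f i == v) F i = \sum_(i | f i \in X) F i.
Proof.
move=> finX; rewrite fsbig_finite //= (exchange_big_dep xpredT) //=.
rewrite [RHS]big_mkcond; apply: eq_bigr => i _.
under eq_bigl do rewrite eq_sym; rewrite -big_filter.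
case: ifPn => [fX|/negP fX].
  by rewrite filter_pred1_uniq ?fset_uniq ?in_fset_set // big_seq1.
rewrite big1_seq // => v /=; rewrite mem_filter => /andP[/eqP ->].
by rewrite in_fset_set.
Qed.

(** * The Mobius function of the flats *)

Section Flats.
Context {R : realType} {d : nat} {I : finType}.
Variables (a : I -> 'rV[R]_d) (b : I -> R).
Hypothesis a_neq0 : forall i, a i != 0.
Implicit Types (S : {set I}) (x : 'rV[R]_d) (u : set 'rV[R]_d).

Definition hyperplane i : set 'rV[R]_d := [set x | dotp (a i) x = b i].

Definition flat_of S : set 'rV[R]_d :=
  [set x | forall i, i \in S -> hyperplane i x].

Definition walls x : {set I} := [set i | dotp (a i) x == b i]%SET.

Lemma hyperplane_neqT i : hyperplane i <> setT.
Proof.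
move=> hT; have [j aj] : exists j, a i 0 j != 0.
  have /rV0Pn := a_neq0 i; exact.
have h0 : hyperplane i 0 by rewrite hT.
have h1 : hyperplane i (a i) by rewrite hT.
have b0 : b i = 0.
  by rewrite -h0 /dotp big1 // => k _; rewrite mxE mulr0.
move: h1; rewrite /hyperplane /= b0 /dotp => h1.
have /(_ j isT) := psumr_eq0P (fun k _ => sqr_ge0 (a i 0 k)) h1.
by move=> /eqP; rewrite sqrf_eq0 (negPf aj).
Qed.

Lemma flat_of_subE S x : flat_of S x <-> S \subset walls x.
Proof.
split=> [h|/fintype.subsetP h i /h]; last by rewrite inE => /eqP.
by apply/fintype.subsetP => i /h; rewrite inE => /eqP.
Qed.

Lemma flat_of0 : flat_of finset.set0 = setT.
Proof. by apply/seteqP; split=> // x _ i; rewrite inE. Qed.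

Lemma flat_of_eqT S : flat_of S = setT -> S = finset.set0.
Proof.
move=> ST; apply/eqP/negPn/negP => /finset.set0Pn[i iS].
apply: (@hyperplane_neqT i); apply/seteqP; split=> // x _.
suff : flat_of S x by move=> /(_ i iS).
by rewrite ST.
Qed.

Local Notation H := (range hyperplane).

Lemma flatsP u : flats H u <-> u !=set0 /\ exists S, u = flat_of S.
Proof.
split=> [[u0 [F FH uE]]|[u0 [S uE]]]; split=> //; rewrite uE.
  exists [set i | hyperplane i \in F]%SET; apply/seteqP; split=> x hx.
    by move=> i; rewrite inE => /set_mem; exact: hx.
  move=> k Fk; have [i _ ik] := FH k Fk; rewrite -ik.
  by apply: hx; rewrite inE ik; exact/mem_set.
exists [set k | exists2 i, i \in S & k = hyperplane i].
  by move=> k [i _ ->]; exists i.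
apply/seteqP; split=> x hx; first by move=> k [i iS ->]; exact: hx.
by move=> i iS; apply: hx; exists i.
Qed.

Lemma finite_flats : finite_set (flats H).
Proof.
apply: (@sub_finite_set _ _ (flat_of @` setT)); first last.
  exact/finite_image/finite_finset.
by move=> u /flatsP[_ [S ->]]; exists S.
Qed.

Lemma flats_setT : flats H setT.
Proof.
by apply/flatsP; split; [exists 0 | exists finset.set0; rewrite flat_of0].
Qed.

(** The crosscut theorem. The right-hand side satisfies the Mobius recursion: its
    sum over the flats containing [u] runs over all subsets of the set of
    hyperplanes containing [u], which is empty only if [u] is the whole space. *)
Lemma mobius_flatsE u : flats H u ->
  mobius_flats H setT u = \sum_(S | flat_of S == u) (-1) ^+ #|S|.
Proof.
pose le u v : Prop := (v : set 'rV[R]_d) `<=` u.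
have le_tr u1 u2 u3 : le u1 u2 -> le u2 u3 -> le u1 u3.
  by move=> h1 h2 x /h2/h1.
have le_anti u1 u2 : le u1 u2 -> le u2 u1 -> u1 = u2.
  by move=> h1 h2; apply/seteqP.
have [n] := ubnP (ncard (below (flats H) le setT u)).
elim: n u => // n IH u un fu.
have [uT|/eqP uT] := eqVneq setT u.
  rewrite -uT /mobius_flats mobius_xx //; last exact: flats_setT.
    rewrite (eq_bigl (pred1 finset.set0)).
      by rewrite big_pred1_eq cards0.
    move=> S /=; apply/eqP/eqP => [/flat_of_eqT//|->]; exact: flat_of0.
  exact: finite_flats.
rewrite /mobius_flats mobius_lt //; last exact: finite_flats.
rewrite -/le.
rewrite (eq_fsbigr (fun v => \sum_(S | flat_of S == v) (-1) ^+ #|S|));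
  last first.
  move=> v /set_mem hv; apply: IH; last by case: hv.
  rewrite ltnS in un; apply: leq_trans un.
  by apply: (ncard_below_lt finite_flats).
rewrite fsbig_fibers; last exact: finite_below finite_flats _ _.
have [[z uz] [S0 uS0]] : u !=set0 /\ exists S, u = flat_of S by exact/flatsP.
pose Au := [set i | `[< u `<=` hyperplane i >]]%SET.
have sub_Au S : (S \subset Au) = `[< u `<=` flat_of S >].
  apply/fintype.subsetP/asboolP => [h x ux i /h|h i iS].
    by rewrite inE => /asboolP; exact.
  by rewrite inE; apply/asboolP => x /h; exact.
have : \sum_(S : {set I} | S \subset Au) (-1) ^+ #|S| = 0 :> int.
  rewrite sum_subset_sign; case: eqP => // Au0; exfalso; apply: uT.
  rewrite uS0 (_ : S0 = finset.set0) ?flat_of0 //; apply/eqP.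
  by rewrite -finset.subset0 -Au0 sub_Au; apply/asboolP; rewrite -uS0.
rewrite (bigID (fun S => flat_of S == u)) /= => /eqP; rewrite addr_eq0 => /eqP.
rewrite (eq_bigl (fun S => flat_of S == u)); last first.
  move=> S /=; case: eqP => [Su|_]; last by rewrite andbF.
  by rewrite andbT sub_Au; apply/asboolP; rewrite Su.
move=> ->; congr (- _); apply: eq_bigl => S; rewrite sub_Au.
apply/idP/idP => [/set_mem[_ _ us su]|/andP[/asboolP us /eqP su]].
  by apply/andP; split; [exact/asboolP | exact/eqP].
apply/mem_set; split=> //; apply/flatsP; split; last by exists S.
by exists z; exact: us.
Qed.

Lemma flat_of_ann S x y : S \subset walls x ->
  flat_of S y <-> form_span a 0 S *m (y - x)^T = 0.
Proof.
move=> /fintype.subsetP Sx; rewrite ann_form_span mul0mx.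
have E i : i \in S -> dotp (a i) (y - x) = dotp (a i) y - b i.
  move=> /Sx; rewrite inE => /eqP <-.
  by rewrite -scaleN1r dotpDr dotpZr mulN1r.
split=> [h|[_ h]]; first by split=> // i iS; rewrite E // (h i iS) subrr.
by move=> i iS; apply/eqP; rewrite -subr_eq0 -E // h.
Qed.

(** Around a common point, flats are determined by the span of their normal
    vectors; in particular all the sets [S] with a given intersection have the
    same rank. *)
Lemma flat_of_eq_span S S0 x : S0 \subset walls x ->
  (flat_of S == flat_of S0) =
  (S \subset walls x) && (form_span a 0 S == form_span a 0 S0)%MS.
Proof.
move=> S0x; apply/eqP/andP => [E|[Sx /andP[le1 le2]]].
  have Sx : S \subset walls x by apply/flat_of_subE; rewrite E; apply/flat_of_subE.
  split=> //; apply/andP; split; apply: ann_submx => z.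
    have := flat_of_ann (x + z) Sx; have := flat_of_ann (x + z) S0x.
    by rewrite (addrC x) addrK E; tauto.
  have := flat_of_ann (x + z) Sx; have := flat_of_ann (x + z) S0x.
  by rewrite (addrC x) addrK E; tauto.
apply/seteqP; split=> y.
  by move=> /(flat_of_ann _ Sx)/(submx_ann le2)/(flat_of_ann _ S0x).
by move=> /(flat_of_ann _ S0x)/(submx_ann le1)/(flat_of_ann _ Sx).
Qed.

(** By [flat_of_eq_span] the sum is the crosscut sum times the constant sign
    (-1)^(rank of u), and it is nonnegative. *)
Lemma abs_mobius_flatsE u : flats H u ->
  `|mobius_flats H setT u| = \sum_(S | flat_of S == u) whitney_sign a 0 S.
Proof.
move=> fu; have [[x ux] [S0 uS0]] := (flatsP u).1 fu.
have S0x : S0 \subset walls x by apply/flat_of_subE; rewrite -uS0.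
have E S := flat_of_eq_span S S0x.
have ge0 : 0 <= \sum_(S | flat_of S == u) whitney_sign a 0 S.
  by rewrite uS0 (eq_bigl _ _ E); exact: whitney_sum_ge0.
have signE : \sum_(S | flat_of S == u) whitney_sign a 0 S =
    (-1) ^+ \rank (form_span a 0 S0) * mobius_flats H setT u.
  rewrite mobius_flatsE // mulr_sumr; apply: eq_bigr => S.
  rewrite uS0 E => /andP[_ /eqmxP eS].
  by rewrite /whitney_sign mxrank0 addn0 eS exprD mulrC.
by rewrite -(ger0_norm ge0) signE normrM normrX normrN1 expr1n mul1r.
Qed.

Theorem sum_mobius_at x :
  \sum_(u \in [set u | flats H u /\ u x]) mobius_flats H setT u =
  (walls x == finset.set0)%:Z.
Proof.
rewrite (eq_fsbigr (fun v => \sum_(S | flat_of S == v) (-1) ^+ #|S|));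
  last first.
  by move=> u /set_mem[fu _]; exact: mobius_flatsE.
rewrite fsbig_fibers; last by apply: sub_finite_set finite_flats => u [].
rewrite -sum_subset_sign; apply: eq_bigl => S; apply/idP/idP.
  by move=> /set_mem[_ /flat_of_subE].
move=> /flat_of_subE Sx; apply/mem_set; split=> //; apply/flatsP.
by split; [exists x | exists S].
Qed.

Theorem sum_abs_mobius_at x :
  \sum_(u \in [set u | flats H u /\ u x]) `|mobius_flats H setT u| =
  \sum_(s : {set I} | s \subset walls x)
     (`[< realizable a 0 (walls x) s >] : nat)%:Z.
Proof.
rewrite count_realizable.
rewrite (eq_fsbigr (fun v => \sum_(S | flat_of S == v) whitney_sign a 0 S));
  last first.
  by move=> u /set_mem[fu _]; exact: abs_mobius_flatsE.
rewrite fsbig_fibers; last by apply: sub_finite_set finite_flats => u [].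
apply: eq_bigl => S; apply/idP/idP.
  by move=> /set_mem[_ /flat_of_subE].
move=> /flat_of_subE Sx; apply/mem_set; split=> //; apply/flatsP.
by split; [exists x | exists S].
Qed.

End Flats.

(** * Regions of a convex set around a point *)

Section Regions.
Context {R : realType} {d : nat} {I : finType}.
Variables (a : I -> 'rV[R]_d) (b : I -> R) (P : set 'rV[R]_d).
Hypothesis P_convex : forall x y c, P x -> P y -> 0 <= c <= 1 ->
  P (x + c *: (y - x)).
Implicit Types (s : {set I}) (x y z : 'rV[R]_d).

Local Notation H := (range (hyperplane a b)).
Local Notation walls := (walls a b).
Let A := P `\` \bigcup_(h in H) h.

Definition positive_side x : {set I} := [set i | b i < dotp (a i) x]%SET.

Definition cell s : set 'rV[R]_d := [set x | P x /\ forall i,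
  if i \in s then b i < dotp (a i) x else dotp (a i) x < b i].

Lemma dotp_segment (v : 'rV[R]_d) x y c :
  dotp v (x + c *: (y - x)) = dotp v x + c * (dotp v y - dotp v x).
Proof. by rewrite dotpDr dotpZr -scaleN1r dotpDr dotpZr mulN1r. Qed.

Lemma cell_segment s x y c : cell s x -> cell s y -> 0 <= c <= 1 ->
  cell s (x + c *: (y - x)).
Proof.
move=> [Px sx] [Py sy] c01; split; first exact: P_convex.
move=> i; move: (sx i) (sy i) c01; rewrite dotp_segment.
have [->|c_neq0] := eqVneq c 0; first by rewrite mul0r addr0.
case: (i \in s) => hx hy /andP[c0 c1].
  have h1 : 0 < c * (dotp (a i) y - b i).
    by rewrite mulr_gt0 ?subr_gt0 // lt_neqAle eq_sym c_neq0.
  have h2 : 0 <= (1 - c) * (dotp (a i) x - b i).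
    by rewrite mulr_ge0 ?subr_ge0 // ltW.
  lra.
have h1 : 0 < c * (b i - dotp (a i) y).
  by rewrite mulr_gt0 ?subr_gt0 // lt_neqAle eq_sym c_neq0.
have h2 : 0 <= (1 - c) * (b i - dotp (a i) x).
  by rewrite mulr_ge0 ?subr_ge0 // ltW.
lra.
Qed.

Lemma cell_off s x : cell s x -> A x.
Proof.
move=> [Px sx]; split=> // -[h [i _ <-]]; rewrite /hyperplane /= => E.
by have := sx i; rewrite E ltxx; case: ifP.
Qed.

Lemma cell_positive_side s x : cell s x -> positive_side x = s.
Proof.
move=> [Px sx]; apply/setP => i; rewrite inE; have := sx i.
by case: (i \in s) => // h; apply/negbTE; rewrite -leNgt ltW.
Qed.

Lemma off_cell x : A x -> cell (positive_side x) x.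
Proof.
move=> [Px Hx]; split=> // i; rewrite inE; case: ltgtP => // E.
by exfalso; apply: Hx; exists (hyperplane a b i) => //; exists i.
Qed.

Lemma segment_continuous x y : continuous (fun c : R => x + c *: (y - x)).
Proof.
move=> c; apply: cvgD; first exact: cvg_cst.
by apply: cvgZr_tmp; exact: cvg_id.
Qed.

(** On a connected set avoiding the hyperplanes no affine form changes sign, by
    the intermediate value theorem; and a cell is connected by segments. *)
Lemma component_cell x : A x ->
  connected_component A x = cell (positive_side x).
Proof.
move=> Ax; apply/seteqP; split=> y.
  move=> Cy; set C := connected_component A x.
  have CA : C `<=` A by exact: connected_component_sub.
  have [Py _] := CA y Cy.
  suff -> : positive_side x = positive_side y by apply: off_cell; exact: CA.
  have itv i : is_interval (dotp (a i) @` C).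
    apply/connected_intervalP; apply: connected_continuous_connected.
      exact: component_connected.
    by apply: continuous_subspaceT; exact: dotp_continuous.
  have xC i : (dotp (a i) @` C) (dotp (a i) x).
    by exists x => //; exact: connected_component_refl.
  have yC i : (dotp (a i) @` C) (dotp (a i) y) by exists y.
  have nb i : ~ (dotp (a i) @` C) (b i).
    move=> [w /CA[_ Hw] wb]; apply: Hw.
    by exists (hyperplane a b i) => //; exists i.
  apply/setP => i; rewrite !inE; apply/idP/idP => h; rewrite ltNge;
    apply/negP => h'; apply: (nb i).
    by apply: (itv i _ _ (yC i) (xC i)); rewrite h' ltW.
  by apply: (itv i _ _ (xC i) (yC i)); rewrite h' ltW.
move=> cy; have cx := off_cell Ax.
pose S := (fun c : R => x + c *: (y - x)) @` `[0, 1].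
have : S `<=` connected_component A x.
  apply: connected_component_max.
  - by exists 0; [rewrite /= in_itv /= lexx ler01 | rewrite scale0r addr0].
  - move=> _ [c c01 <-]; apply: (@cell_off (positive_side x)).
    by apply: cell_segment => //; move: c01; rewrite /= in_itv.
  - apply: connected_continuous_connected; first exact: segment_connected.
    by apply: continuous_subspaceT; exact: segment_continuous.
apply; exists 1; first by rewrite /= in_itv /= lexx ler01.
by rewrite scale1r addrC subrK.
Qed.

Lemma closure_cell_side s x i : closure (cell s) x ->
  (b i < dotp (a i) x -> i \in s) /\ (dotp (a i) x < b i -> i \notin s).
Proof.
move=> cx; split=> [/near_dotp_gt|/near_dotp_lt] /cx[y [[_ /(_ i)]]] + h;
  rewrite /= in h.
  by case: (i \in s) => //; rewrite ltNge (ltW h).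
by case: (i \in s) => //; rewrite ltNge (ltW h).
Qed.

Lemma wallsNP x i : i \notin walls x ->
  i \in positive_side x \/ dotp (a i) x < b i.
Proof. by rewrite !inE neq_lt => /orP[h|h]; [right|left]. Qed.

(** Off the walls, the strict inequalities satisfied by [x] persist at the points
    of the cell that are close to [x]. *)
Lemma closure_cellE s x : closure (cell s) x ->
  s = positive_side x :|: (s :&: walls x).
Proof.
move=> cx; apply/setP => i; rewrite !inE.
have [h1 h2] := closure_cell_side i cx.
have [/h1 -> //|/h2/negPf -> //|_] := ltgtP (b i) (dotp (a i) x).
by rewrite andbT.
Qed.

Lemma cell_realizable s x z : cell s z ->
  realizable a 0 (walls x) (s :&: walls x).
Proof.
move=> [_ sz]; exists (z - x); split; first by rewrite mul0mx.
move=> i ix; rewrite inE ix andbT; move: ix; rewrite inE => /eqP ix.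
have -> : dotp (a i) (z - x) = dotp (a i) z - b i.
  by rewrite -scaleN1r dotpDr dotpZr ix mulN1r.
by have := sz i; case: ifP; rewrite ?subr_gt0 ?subr_lt0.
Qed.

(** If [w] realizes the pattern [s] on the walls of [x], the segment from [x] to
    [y + e *: w] enters the cell prescribed by [s]: on a wall both [x] and [y]
    have value [b i], so that only the sign of [w] matters, while off the walls
    the signs of [x] persist near [x]. The point [y] serves to keep the segment
    in [P]. *)
Lemma realizable_closure s x y : P x ->
  (\forall y' \near y, P y') -> flat_of a b (walls x) y ->
  s \subset walls x -> realizable a 0 (walls x) s ->
  closure (cell (positive_side x :|: s)) x.
Proof.
move=> Px nPy fy sx [w [_ hw]].
have [e e0 Pe] : exists2 e : R, 0 < e & P (y + e *: w).
  have : \forall e \near (0 : R), P (y + e *: w) by exact: (@cvg_line _ _ y w _ nPy).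
  move=> /nbhs_ballP[e /= e0 he]; exists (e / 2); first exact: divr_gt0.
  apply: he; rewrite /ball /= sub0r normrN gtr0_norm ?divr_gt0 //.
  by rewrite ltr_pdivrMr // ltr_pMr // ltr1n.
set y' := y + e *: w in Pe.
have wallE i c : i \in walls x ->
    dotp (a i) (x + c *: (y' - x)) = b i + c * (e * dotp (a i) w).
  move=> ix; rewrite dotp_segment /y' dotpDr dotpZr (fy i ix).
  by move: ix; rewrite inE => /eqP ->; congr (_ + _ * _); rewrite addrC addKr.
move=> B Bx.
pose far i z := i \notin walls x ->
  if i \in positive_side x then b i < dotp (a i) z else dotp (a i) z < b i.
have nfar : \forall z \near x, forall i, far i z.
  apply: (@filter_forall _ _ far (nbhs x)) => i.
  have [ix|ix] := boolP (i \in walls x); first by apply: nearW => z; rewrite /far ix.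
  have [ip|xi] := wallsNP ix.
    have := ip; rewrite inE => /near_dotp_gt; apply: filterS => z hz.
    by rewrite /far ip.
  apply: filterS (near_dotp_lt xi) => z hz.
  by rewrite /far !inE (lt_gtF xi).
have : \forall c \near (0 : R), B (x + c *: (y' - x)) /\
                                forall i, far i (x + c *: (y' - x)).
  exact: (@cvg_line _ _ x (y' - x) _ (filterI Bx nfar)).
move=> /nbhs_ballP[r /= r0 hr].
pose c : R := Num.min (r / 2) 1.
have c0 : 0 < c by rewrite lt_min divr_gt0 ?ltr01.
have c1 : c <= 1 by rewrite ge_min lexx orbT.
have cr : c < r.
  by rewrite gt_min ltr_pdivrMr // ltr_pMr // ltr1n.
have [] : B (x + c *: (y' - x)) /\ forall i, far i (x + c *: (y' - x)).
  by apply: hr; rewrite /ball /= sub0r normrN gtr0_norm.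
move=> Bc farc; exists (x + c *: (y' - x)); split=> //; split.
  by apply: P_convex => //; rewrite c1 ltW.
move=> i; have [ix|ix] := boolP (i \in walls x); last first.
  have -> : (i \in positive_side x :|: s) = (i \in positive_side x).
    by rewrite inE (contraNF (fintype.subsetP sx i) ix) orbF.
  exact: farc.
have := hw i ix; rewrite wallE // !inE.
have -> /= : (b i < dotp (a i) x) = false.
  by move: ix; rewrite inE => /eqP ->; rewrite ltxx.
case: ifP => _ h; first by rewrite ltrDl !mulr_gt0.
by rewrite -[ltRHS]addr0 ltrD2l !pmulr_rlt0.
Qed.

Lemma cell_neq0 s x : closure (cell s) x -> cell s !=set0.
Proof. by move=> /(_ setT filterT)[z [cz _]]; exists z. Qed.

Lemma closed_regionsP (C : set 'rV[R]_d) :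
  closed_regions P H C <-> exists s, cell s !=set0 /\ C = closure (cell s).
Proof.
split=> [[z Az <-]|[s [[z cz] ->]]].
  exists (positive_side z); split; first by exists z; exact: off_cell.
  by rewrite -component_cell.
have Az := cell_off cz; exists z => //.
by rewrite [connected_component _ _]component_cell // (cell_positive_side cz).
Qed.

(** A point of one cell satisfies some strict inequality that is reversed on any
    other given cell, so it is not in the closure of the latter; hence counting
    closed regions amounts to counting cells. *)
Lemma closure_cell_inj s t : cell s !=set0 ->
  closure (cell s) = closure (cell t) -> s = t.
Proof.
move=> [z cz] E; have Az := cell_off cz.
have czt : closure (cell t) z by rewrite -E; exact: subset_closure.
rewrite -(cell_positive_side cz); apply/setP => i; rewrite inE.
have [h1 h2] := closure_cell_side i czt; have [_ /(_ i)] := off_cell Az.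
rewrite inE; case: ifP => [/h1 -> //|_ /h2/negPf -> //].
Qed.

Lemma closed_regions_at x y : P x ->
  (\forall y' \near y, P y') -> flat_of a b (walls x) y ->
  [set C | closed_regions P H C /\ C x] =
  (fun s => closure (cell (positive_side x :|: s))) @`
    [set s : {set I} | s \subset walls x /\ realizable a 0 (walls x) s].
Proof.
move=> Px nPy fy; apply/seteqP; split=> [C [/closed_regionsP[s [[z cz] ->]] cx]|].
  exists (s :&: walls x); last by rewrite /= -closure_cellE.
  by split; [exact: finset.subsetIr | exact: cell_realizable cz].
move=> _ [s [sx rs] <-]; have cx := realizable_closure Px nPy fy sx rs.
by split=> //; apply/closed_regionsP; exists (positive_side x :|: s);
  split=> //; exact: cell_neq0 cx.
Qed.

Theorem multiplicityE x y : P x ->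
  (\forall y' \near y, P y') -> flat_of a b (walls x) y ->
  (multiplicity P H x)%:Z =
  \sum_(s : {set I} | s \subset walls x)
     (`[< realizable a 0 (walls x) s >] : nat)%:Z.
Proof.
move=> Px nPy fy; rewrite /multiplicity mem_set // (closed_regions_at Px nPy fy).
rewrite ncardE; last exact/finite_image/finite_finset.
rewrite fsbig_image; last first.
  move=> s t /set_mem[sx rs] /set_mem[tx _] E.
  have cs := realizable_closure Px nPy fy sx rs.
  have Est := closure_cell_inj (cell_neq0 cs) E.
  have disj (r : {set I}) : r \subset walls x ->
      (positive_side x :|: r) :&: walls x = r.
    move=> /fintype.subsetP rx; apply/setP => i; rewrite !inE.
    have := rx i; rewrite inE; case: (i \in r) => [/(_ isT) ->|_].
      by rewrite orbT.
    by rewrite orbF; case: ltgtP; rewrite ?andbF.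
  by rewrite -(disj s sx) -(disj t tx) Est.
transitivity (\sum_(s \in [set s : {set I} | s \subset walls x /\
    realizable a 0 (walls x) s]) \sum_(t : {set I} | id t == s) (1 : int)).
  by apply: eq_fsbigr => s _; rewrite big_pred1_eq.
rewrite fsbig_fibers; last exact: finite_finset.
rewrite big_mkcond [RHS]big_mkcond; apply: eq_bigr => s _.
rewrite (_ : (_ \in _) =
  (s \subset walls x) && `[< realizable a 0 (walls x) s >]).
  by case: (s \subset _); case: asboolP.
apply/idP/andP => [/set_mem[? ?]|[? /asboolP ?]]; last exact/mem_set.
by split=> //; exact/asboolP.
Qed.

End Regions.

(** * Polytopes and lattice points *)

Section Polytopes.
Context {R : realType} {d : nat}.
Implicit Types (P D : set 'rV[R]_d) (x y : 'rV[R]_d).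

Lemma polytope_convex P x y c : polytope P -> P x -> P y -> 0 <= c <= 1 ->
  P (x + c *: (y - x)).
Proof.
move=> [_ _ [F [_ Fh ->]]] Px Py /andP[c0 c1] h Fhh.
have [v [r [_ hE]]] := Fh h Fhh; have := Px h Fhh; have := Py h Fhh.
have [->|c_neq0] := eqVneq c 0; first by rewrite scale0r addr0.
have cp : 0 < c by rewrite lt_neqAle eq_sym c_neq0.
have oc : 0 <= 1 - c by rewrite subr_ge0.
case: hE => -> /=; rewrite dotp_segment => hy hx.
  have h1 : 0 <= c * (r - dotp v y) by rewrite mulr_ge0 ?subr_ge0.
  have h2 : 0 <= (1 - c) * (r - dotp v x) by rewrite mulr_ge0 ?subr_ge0.
  lra.
have h1 : 0 < c * (r - dotp v y) by rewrite mulr_gt0 ?subr_gt0.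
have h2 : 0 <= (1 - c) * (r - dotp v x) by rewrite mulr_ge0 ?subr_ge0 // ltW.
lra.
Qed.

Lemma near_relint P x : full_dimensional P -> relint P x ->
  \forall y \near x, P y.
Proof. by move=> PT [_]; rewrite PT; apply: filterS => y; exact. Qed.

(** A compact ball is covered by finitely many of the neighbourhoods that meet
    [D] in a finite set; it is taken large enough to contain the dilate of [P]. *)
Lemma finite_lattice_points D P t : locally_finite D -> bounded_set P ->
  (0 < t)%N -> finite_set (P `&` dilate_inv t D).
Proof.
move=> locD bP t0.
have t_neq0 : t%:R != 0 :> R by rewrite pnatr_eq0 -lt0n.
have [M [_ hM]] : exists M : R, 0 < M /\ forall x, P x -> `|x| <= M.
  have [M [_ hM]] := bP; exists (`|M| + 1); split; first by rewrite ltr_wpDl.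
  by move=> x; apply: hM; rewrite (le_lt_trans (ler_norm M)) // ltrDl.
pose K : set 'rV[R]_d := [set x | `|x| <= t%:R * M].
have cK : compact K.
  apply: bounded_closed_compact.
    exists (t%:R * M); split; first exact: num_real.
    by move=> r rM x /= /le_trans; apply; exact: ltW.
  apply: (@closed_comp _ _ (fun x : 'rV[R]_d => `|x|) [set r | r <= t%:R * M]).
    by move=> x _; exact: norm_continuous.
  exact: closed_le.
have finDK : finite_set (D `&` K).
  have /choice[U hU] : forall x, exists U, nbhs x U /\ finite_set (D `&` U).
    by move=> x; have [U ? ?] := locD x; exists U.
  have := cK; rewrite compact_cover.
  move=> /(_ _ setT (fun x => interior (U x)))[].
  - by move=> x _; exact: open_interior.
  - by move=> x _; exists x => //; have [] := hU x.
  move=> X _ KX.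
  apply: (@sub_finite_set _ _ (\bigcup_(x in [set` X]) (D `&` U x))).
    move=> x [Dx /KX[y Xy Uy]]; exists y => //; split=> //.
    exact: interior_subset.
  by apply: bigcup_finite => // x _; have [] := hU x.
apply: (@sub_finite_set _ _ ((fun x => t%:R^-1 *: x) @` (D `&` K))).
  move=> x [Px [y Dy yx]]; exists y => //; split=> //.
  have -> : y = t%:R *: x by rewrite -yx scalerA divff // scale1r.
  by rewrite /K /= normrZ normr_nat ler_wpM2l // hM.
exact: finite_image.
Qed.

Lemma arrangement_forms (H : set (set 'rV[R]_d)) : arrangement H -> ~ H setT ->
  exists (I : finType) (a : I -> 'rV[R]_d) (b : I -> R),
    (forall i, a i != 0) /\ H = range (hyperplane a b).
Proof.
move=> [finH Hh] HT; pose I : finType := fset_set H.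
have memH (i : I) : H (val i) by have := valP i; rewrite in_fset_set // => /set_mem.
have /choice[ab hab] : forall i : I, exists ab : 'rV[R]_d * R,
    ab.1 != 0 /\ val i = [set x | dotp ab.1 x = ab.2].
  move=> i; have [[v [r [v0 ir]]]|iT] := Hh _ (memH i); first by exists (v, r).
  by exfalso; apply: HT; rewrite -iT; exact: memH.
exists I, (fun i => (ab i).1), (fun i => (ab i).2); split=> [i|].
  by have [] := hab i.
have E i : hyperplane (fun i => (ab i).1) (fun i => (ab i).2) i = val i.
  by have [_ ->] := hab i.
apply/seteqP; split=> [h Hh'|_ [i _ <-]]; last by rewrite E.
have hI : h \in fset_set H by rewrite in_fset_set //; exact/mem_set.
by exists [` hI]%fset => //; rewrite E.
Qed.

End Polytopes.

Lemma sum_incidence (T : choiceType) (X : set T) (L : set (set T))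
    (g : set T -> int) : finite_set X -> finite_set L ->
  \sum_(u \in L) g u * (ncard (X `&` u))%:Z =
  \sum_(x \in X) \sum_(u \in [set u | L u /\ u x]) g u.
Proof.
move=> finX finL.
transitivity (\sum_(u \in L) \sum_(x \in X) if `[< u x >] then g u else 0).
  apply: eq_fsbigr => u _; rewrite ncardE; last exact: finite_setIl.
  rewrite fsbig_mkcondr mulr_fsumr; apply: eq_fsbigr => x _.
  by rewrite /patch -[x \in u]/(`[< u x >]); case: ifP; rewrite ?mulr1 ?mulr0.
rewrite exchange_fsbig //; apply: eq_fsbigr => x _.
rewrite (_ : [set u | L u /\ u x] = L `&` [set u | u x]) //.
rewrite [RHS]fsbig_mkcondr; apply: eq_fsbigr => u _.
by rewrite /patch -[u \in _]/(`[< u x >]).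
Qed.

(** * Lattice point counts of an arrangement in a polytope *)

Theorem theorem4p2 (R : realType) (d : nat)
    (D P : set 'rV[R]_d) (H : set (set 'rV[R]_d))
    (D_lattice : discrete_lattice D) (D0 : D 0) (D_full : full_dimensional D)
    (P_polytope : polytope P) (P_full : full_dimensional P)
    (P_frac : fractional_polytope D P)
    (H_arr : arrangement H) (H_frac : fractional_arrangement D H)
    (H_nondeg : ~ H setT) :
  (forall t : nat, (0 < t)%N ->
     (ehrhart_open D (relint P) H t)%:Z =
     \sum_(u \in flats H)
        mobius_flats H setT u * (ehrhart D (relint P `&` u) t)%:Z) /\
  (transverse H P ->
   forall t : nat, (0 < t)%N ->
     (ehrhart_closed D P H t)%:Z =
     \sum_(u \in flats H)
        `|mobius_flats H setT u| * (ehrhart D (P `&` u) t)%:Z).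
Proof.
have [I [a [b [a_neq0 HE]]]] := arrangement_forms H_arr H_nondeg.
have [locD _] := D_lattice; have [P_bounded _ _] := P_polytope.
have finP t : (0 < t)%N -> finite_set (P `&` dilate_inv t D).
  exact: finite_lattice_points.
rewrite HE; have finL := finite_flats a b.
have ehrhartE Q u t : ehrhart D (Q `&` u) t = ncard (Q `&` dilate_inv t D `&` u).
  by rewrite /ehrhart setIAC.
split=> [t t0|[Htrans _] t t0].
  have finX : finite_set (relint P `&` dilate_inv t D).
    by apply: sub_finite_set (finP t t0) => x [[]].
  under eq_fsbigr do rewrite ehrhartE.
  rewrite sum_incidence //.
  under [RHS]eq_fsbigr do rewrite sum_mobius_at //.
  rewrite /ehrhart_open setIC ncardE; last first.
    by apply: sub_finite_set finX => x [[]].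
  rewrite setIDAC setDE setIA fsbig_mkcondr. apply: eq_fsbigr => x _.
  rewrite /patch; case: ifPn => /= [/set_mem xH|/negP xH].
    suff -> : walls a b x = finset.set0 by rewrite eqxx.
    apply/setP => i; rewrite !inE; apply/negP => /eqP xi; apply: xH.
    by exists (hyperplane a b i) => //; exists i.
  case: eqP => // x0; exfalso; apply: xH; apply/mem_set => -[h [i _ <-]] hx.
  have : i \in walls a b x by rewrite inE; exact/eqP.
  by rewrite x0 inE.
have finX := finP t t0.
under eq_fsbigr do rewrite ehrhartE.
rewrite sum_incidence //.
under [RHS]eq_fsbigr do rewrite sum_abs_mobius_at //.
rewrite /ehrhart_closed -(fsbig_widen (P `&` dilate_inv t D) (dilate_inv t D)
  (multiplicity P (range (hyperplane a b)))); last 2 first.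
- by move=> x [].
- move=> x [Dx xP] /=; rewrite /multiplicity; case: ifPn => // /set_mem Px.
  by exfalso; apply: xP.
rewrite !fsbig_finite //= (big_morph Posz PoszD (erefl _)).
apply: eq_big_seq => x; rewrite in_fset_set // => /set_mem[Px _].
have fx : flats (range (hyperplane a b)) (flat_of a b (walls a b x)).
  apply/flatsP; split; last by exists (walls a b x).
  by exists x; exact/flat_of_subE.
have [y [fy Py]] : flat_of a b (walls a b x) `&` relint P !=set0.
  apply: Htrans => //; exists x; split; first exact/flat_of_subE.
  exact: subset_closure.
apply: (multiplicityE _ Px _ fy).
  by move=> z w c; exact: polytope_convex.
exact: near_relint.
Qed.
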